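(* Let $\alpha$ be a reward sharing scheme. Then $\alpha$ satisfies round based rewards, budget limit, fixed total reward, ordinality and absolute redistribution if and only if $\alpha$ is an absolute fair scheme, i.e. if and only if there exist a constant $R=B-f$ with $f\in[0,B]$ and a function $\varepsilon:\mathbb{N}\to[0,1]$ with $\varepsilon(1)=1$ and $\varepsilon(n)\ge\sum_{i=n+1}^{\infty}\frac{\varepsilon(i)}{i-1}$ for every $n\in\mathbb{N}$, such that for every history $H=(S,\mathcal{P}(S))$ and every share $s\in S$, $$\alpha(s,H)=R\Big(\varepsilon(\rho(s))-\sum_{i=\rho(s)+1}^{|P(s)|}\frac{\varepsilon(i)}{i-1}\Big),$$ where an empty sum equals $0$.
   Context: $\mathbb{N}=\{1,2,3,\dots\}$. $B>0$ is a fixed constant (the block reward). Shares and histories. Let $\mathcal{S}$ be a nonempty set (of admissible hashes) and $T=\mathbb{R}$ the set of time signatures. A share is a pair $s=(h,t)\in\mathcal{S}\times T$; its time signature is $\tau(s)=t$. A history is a pair $H=(S,\mathcal{P}(S))$ where $S=\{s_1,\dots,s_m\}$ is a nonempty finite set of shares with pairwise distinct time signatures, listed in increasing order of time signature, and $\mathcal{P}(S)=\{P_1,\dots,P_l\}$ is a partition of $S$ into nonempty sets of consecutive shares, called rounds, numbered in chronological order (the last share of each round is the ''full solution'' ending that round; this information is carried only by the partition). For $s\in S$, $P(s)$ is the round containing $s$, and $\rho(s)=|\{s'\in P(s):\tau(s')<\tau(s)\}|+1$ is the rank of $s$ in its round. A reward sharing scheme $\alpha$ assigns to every history $H=(S,\mathcal{P}(S))$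 and every $s\in S$ an award $\alpha(s,H)\in\mathbb{R}_+=[0,\infty)$. Restriction: for a history $H$ and a round $P_r$ of it, $H|_r=(P_r,\{P_r\})$. Extension: $H'=(S',\mathcal{P}'(S'))$ is an extension of $H$ at the $r$-th round if $S'=S\cup\{s^*\}$ for a share $s^*\notin S$ with $\tau(\underline{s})<\tau(s^* )<\tau(\overline{s})$ for all $\underline{s}\in P_r$ and all $\overline{s}\in P_{r+1}$ (the latter inequality only if round $r+1$ exists), $P'_k=P_k$ for all $k\ne r$, and $P'_r=P_r\cup\{s^*\}$. Time-shift: for $s_i\in P_r$, $H'=(S',\mathcal{P}'(S'))$ is a time-shift of $H$ at $s_i$ if $S'=(S\setminus\{s_i\})\cup\{s_i'\}$ for some share $s_i'\in(\mathcal{S}\times T)\setminus S$ with $\tau(s_{i-1})<\tau(s_i')<\tau(s_{i+1})$ (an inequality being dropped if the corresponding neighbouring share does not exist), $P'_j=P_j$ for all $j\neq r$, and hence $P'_r=(P_r\setminus\{s_i\})\cup\{s_i'\}$. Axioms for a scheme $\alpha$: - Fixed total reward: for every history $H=(S,\mathcal{P}(S))$ and all rounds $P,P'\in\mathcal{P}(S)$, $\sum_{s\in P}\alpha(s,H)=\sum_{s\in P'}\alpha(s,H)$. - Ordinality: for every $H=(S,\mathcal{P}(S))$ and every time-shift $H'$ of $H$ at any $s_i\in S$, $\alpha(s,H)=\alpha(s,H')$ for all $s\in S\setminus\{s_i\}$. - Budget limit: for every history $H$ and every round $P$ of $H$, $\sum_{s\in P}\alpha(s,H)\le B$. - Round based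 rewards: for every history $H$, every round $P_r$ of $H$ and every $s\in P_r$, $\alpha(s,H)=\alpha(s,H|_r)$. - Absolute redistribution: for every history $H$, every round $P_r$ with $|P_r|>1$, every extension $H'$ of $H$ at the $r$-th round, and all $s_i,s_j\in P_r$, $\alpha(s_i,H)-\alpha(s_i,H')=\alpha(s_j,H)-\alpha(s_j,H')$. *)

(* Defs.v *)
From mathcomp Require Import all_boot all_order all_algebra finmap.
From mathcomp Require Import boolp classical_sets reals ereal topology.
From mathcomp Require Import normedtype sequences.

Set Implicit Arguments.
Unset Strict Implicit.
Unset Printing Implicit Defensive.

Import Order.TTheory GRing.Theory Num.Theory.

Local Open Scope fset_scope.
Local Open Scope ring_scope.

Notation share R hash := (Choice.sort hash * Real.sort R)%type.

Definition tau (R : realType) (hash : choiceType) (s : share R hash) : R := s.2.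

(* The partition is carried by its chronological enumeration: [rounds] lists
   the blocks in the order of time, so that the k-th round (counted from 0) is
   the k-th item. Together with [shares_cover], [rounds_chrono] says that the
   blocks are pairwise disjoint, made of consecutive shares, and numbered in
   chronological order; see [rounds_disjoint] and [rounds_consecutive]. *)
Record history (R : realType) (hash : choiceType) := History {
  shares : {fset share R hash};
  rounds : seq {fset share R hash};
  shares_neq0 : shares != fset0;
  tau_inj : {in shares &, injective (@tau R hash)};
  rounds_neq0 : fset0 \notin rounds;
  shares_cover : shares = \bigcup_(P <- rounds) P;
  rounds_chrono : forall j k, (j < k < size rounds)%N ->
    forall s s', s \in nth fset0 rounds j -> s' \in nth fset0 rounds k ->
    tau s < tau s' }.

Section Theory.
Variables (R : realType) (hash : choiceType).
Implicit Types (H : history R hash) (s : share R hash).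

(* Total in k: the empty set when H has no k-th round. *)
Definition round H (k : nat) : {fset share R hash} := nth fset0 (rounds H) k.

Lemma round_shares H k s : s \in round H k -> s \in shares H.
Proof.
rewrite /round => sk; have [kH|Hk] := ltnP k (size (rounds H)); last first.
  by move: sk; rewrite nth_default // in_fset0.
rewrite shares_cover; apply/bigfcupP; exists (nth fset0 (rounds H) k) => //.
by rewrite mem_nth.
Qed.

Lemma round_neq0 H k : (k < size (rounds H))%N -> round H k != fset0.
Proof.
move=> kH; apply: contraNneq (rounds_neq0 H) => <-; exact: mem_nth.
Qed.

Lemma rounds_disjoint H j k s : s \in round H j -> s \in round H k -> j = k.
Proof.
have aux (a b : nat) : (a < b)%N -> s \in round H a -> s \in round H b -> False.
  move=> ab sa sb; have [bH|Hb] := ltnP b (size (rounds H)); last first.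
    by move: sb; rewrite /round nth_default // in_fset0.
  have abH : (a < b < size (rounds H))%N by rewrite ab bH.
  by have := rounds_chrono abH sa sb; rewrite ltxx.
by move=> sj sk; case: (ltngtP j k) => // [/aux|/aux] h; case: h.
Qed.

Lemma rounds_consecutive H k s s' s'' :
  s \in round H k -> s'' \in round H k -> s' \in shares H ->
  tau s < tau s' -> tau s' < tau s'' -> s' \in round H k.
Proof.
move=> sk s''k; rewrite shares_cover => /bigfcupP[P /andP[PH _] s'P] ss' s's''.
have [kH|Hk] := ltnP k (size (rounds H)); last first.
  by move: sk; rewrite /round nth_default // in_fset0.
move: (PH) s'P => /(nthP fset0)[j jH <-] s'j.
case: (ltngtP j k) => [jk|kj|<- //].
- have jkH : (j < k < size (rounds H))%N by rewrite jk kH.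
  by have := lt_trans ss' (rounds_chrono jkH s'j sk); rewrite ltxx.
- have kjH : (k < j < size (rounds H))%N by rewrite kj jH.
  by have := lt_trans s's'' (rounds_chrono kjH s''k s'j); rewrite ltxx.
Qed.

(* The round containing s, when s is a share of H; the empty set otherwise. *)
Definition round_of H s : {fset share R hash} :=
  round H (find (fun P : {fset share R hash} => s \in P) (rounds H)).

Definition rank H s : nat :=
  #|` [fset s' in round_of H s | tau s' < tau s]|.+1.

Section Restriction.
Variables (H : history R hash) (r : 'I_(size (rounds H))).

Lemma restrict_inj : {in round H r &, injective (@tau R hash)}.
Proof. by move=> s s' /round_shares sH /round_shares s'H; exact: (@tau_inj R hash H). Qed.

Lemma restrict_neq0 : fset0 \notin [:: round H r].
Proof. by rewrite inE eq_sym round_neq0. Qed.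

Lemma restrict_cover : round H r = \bigcup_(P <- [:: round H r]) P.
Proof. by rewrite big_seq1. Qed.

Lemma restrict_chrono j k : (j < k < size [:: round H r])%N ->
  forall s s', s \in nth fset0 [:: round H r] j ->
    s' \in nth fset0 [:: round H r] k -> tau s < tau s'.
Proof. by case: k => [|k] /andP[]; rewrite ?ltn0. Qed.

Definition restrict : history R hash :=
  History (round_neq0 (ltn_ord r)) restrict_inj restrict_neq0 restrict_cover
          restrict_chrono.

End Restriction.

(* When r is the last round, [round H r.+1] is empty and the upper bound on
   the time of the new share is void. As rounds are nonempty, equality of all
   the k-th rounds, k != r, also forces H and H' to have equally many rounds. *)
Definition extension H (r : 'I_(size (rounds H))) H' : Prop :=
  exists s' : share R hash,
    [/\ s' \notin shares H,
        (forall s, s \in round H r -> tau s < tau s') /\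
        (forall s, s \in round H r.+1 -> tau s' < tau s),
        shares H' = s' |` shares H,
        (forall k : nat, k != r -> round H' k = round H k) &
        round H' r = s' |` round H r].

(* s' is the share of H that comes right after s. *)
Definition next_share H s s' : Prop :=
  [/\ s \in shares H, s' \in shares H, tau s < tau s' &
      forall s'', s'' \in shares H -> ~~ (tau s < tau s'' < tau s')].

Definition time_shift H (si : share R hash) H' : Prop :=
  exists (r : 'I_(size (rounds H))) (si' : share R hash),
    [/\ si \in round H r,
        si' \notin shares H,
        (forall s, next_share H s si -> tau s < tau si') /\
        (forall s, next_share H si s -> tau si' < tau s),
        shares H' = si' |` (shares H `\ si) &
        (forall k : nat, k != r -> round H' k = round H k) /\
        round H' r = si' |` (round H r `\ si)].

End Theory.

(* [award alpha s H] is only meaningful when s is a share of H. *)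
Record reward_scheme (R : realType) (hash : choiceType) := RewardScheme {
  award :> share R hash -> history R hash -> R;
  award_ge0 : forall H s, s \in shares H -> 0 <= award s H }.

Section Properties.
Variables (R : realType) (hash : choiceType) (alpha : reward_scheme R hash).
Implicit Types (H : history R hash) (s : share R hash).

Definition fixed_total_reward : Prop :=
  forall H P P', P \in rounds H -> P' \in rounds H ->
    \sum_(s <- P) alpha s H = \sum_(s <- P') alpha s H.

Definition ordinality : Prop :=
  forall H si H', si \in shares H -> time_shift H si H' ->
    forall s, s \in shares H `\ si -> alpha s H = alpha s H'.

Definition budget_limit (B : R) : Prop :=
  forall H P, P \in rounds H -> \sum_(s <- P) alpha s H <= B.

Definition round_based_rewards : Prop :=
  forall H (r : 'I_(size (rounds H))) s,
    s \in round H r -> alpha s H = alpha s (restrict r).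

Definition absolute_redistribution : Prop :=
  forall H (r : 'I_(size (rounds H))) H',
    (1 < #|` round H r|)%N -> extension r H' ->
    forall si sj, si \in round H r -> sj \in round H r ->
      alpha si H - alpha si H' = alpha sj H - alpha sj H'.

(* Only the values eps n with 1 <= n matter. The infinite sums are taken in
   the extended reals, where these series of nonnegative terms always have a
   value; bounding them by a real number includes their convergence. *)
Definition absolute_fair (B : R) : Prop :=
  exists (f : R) (eps : nat -> R),
    [/\ 0 <= f <= B,
        eps 1%N = 1,
        (forall n, (1 <= n)%N -> 0 <= eps n <= 1),
        (forall n, (1 <= n)%N ->
           (\sum_(n.+1 <= i <oo) (eps i / (i%:R - 1))%:E <= (eps n)%:E)%E) &
        forall H s, s \in shares H ->
          alpha s H = (B - f) *
            (eps (rank H s) -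
             \sum_((rank H s).+1 <= i < #|` round_of H s|.+1)
                eps i / (i%:R - 1))].

End Properties.

(* Main.v *)
Require Import Defs.
From mathcomp Require Import all_boot all_order all_algebra finmap.
From mathcomp Require Import boolp reals ereal topology.
From mathcomp Require Import normedtype sequences.

(* An award depends only on the rank of a share in its round and on the size of
   the round: the shares of one round can be time-shifted one by one, the last
   first, onto those of a later round of the same size, and the fixed total T
   determines the award of the share being moved. Writing a(k,n) for this
   award, an extension lowers all a(k,n), k <= n, by the same amount, which is
   a(n+1,n+1)/n as both totals are T. Hence
   a(k,n) = a(k,k) - \sum_(k < i <= n) a(i,i)/(i-1), and eps(n) = a(n,n)/T; the
   bound on the series of eps is the limit of a(k,n) >= 0. *)

Set Implicit Arguments.
Unset Strict Implicit.
Unset Printing Implicit Defensive.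

Import Order.TTheory GRing.Theory Num.Theory.

Local Open Scope fset_scope.
Local Open Scope ring_scope.

(** * Finite sets of shares listed in order of time *)

Section Listings.
Variables (R : realType) (hash : choiceType).
Implicit Types (f g : nat -> share R hash) (s : share R hash).
Implicit Types (P : {fset share R hash}) (H : history R hash).

(** Only indices below [n] count, so a single infinite sequence can provide rounds of every size,
    each extending the one before. *)
Definition increasing f n := forall i j, (i < j < n)%N -> tau (f i) < tau (f j).

Definition img f n : {fset share R hash} := [fset x in map f (iota 0 n)].

Lemma imgP f n s : reflect (exists2 i, (i < n)%N & s = f i) (s \in img f n).
Proof.
rewrite in_fset /=; apply: (iffP mapP) => -[i].
  by rewrite mem_iota => ? ->; exists i.
by move=> ? ->; exists i; rewrite // mem_iota.
Qed.

Lemma mem_img f n i : (i < n)%N -> f i \in img f n.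
Proof. by move=> ?; apply/imgP; exists i. Qed.

Lemma img_neq0 f n : img f n.+1 != fset0.
Proof. by apply/fset0Pn; exists (f 0%N); apply: mem_img. Qed.

Lemma eq_img f g n : (forall i, (i < n)%N -> f i = g i) -> img f n = img g n.
Proof.
move=> fg; apply/fsetP => s; apply/imgP/imgP => -[i ? ->]; exists i => //.
all: by rewrite fg.
Qed.

Lemma imgS f n : img f n.+1 = f n |` img f n.
Proof.
apply/fsetP => s; rewrite in_fset1U; apply/imgP/idP => [[i]|].
  rewrite ltnS leq_eqVlt => /orP[/eqP-> ->|? ->]; first by rewrite eqxx.
  by rewrite mem_img ?orbT.
by case/orP => [/eqP->|/imgP[i ? ->]]; [exists n|exists i => //; exact: ltnW].
Qed.

Lemma increasingW f m n : (m <= n)%N -> increasing f n -> increasing f m.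
Proof.
by move=> mn f_incr i j /andP[ij jm]; rewrite f_incr // ij (leq_trans jm).
Qed.

Lemma increasing_lt f n i j : increasing f n -> (i < n)%N -> (j < n)%N ->
  (tau (f i) < tau (f j)) = (i < j)%N.
Proof.
move=> f_incr i_lt j_lt; case: ltngtP => [ij|ji|->]; last by rewrite ltxx.
  by rewrite f_incr ?ij.
by apply/negbTE; rewrite -leNgt ltW // f_incr ?ji.
Qed.

Lemma increasing_inj f n i j : increasing f n -> (i < n)%N -> (j < n)%N ->
  tau (f i) = tau (f j) -> i = j.
Proof.
move=> f_incr i_lt j_lt e; case: (ltngtP i j) => // ij.
  by move: ij; rewrite -(increasing_lt f_incr) // e ltxx.
by move: ij; rewrite -(increasing_lt f_incr) // e ltxx.
Qed.

Lemma tau_inj_img f n : increasing f n -> {in img f n &, injective (@tau R hash)}.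
Proof.
move=> f_incr _ _ /imgP[i ? ->] /imgP[j ? ->] e.
by rewrite (increasing_inj f_incr _ _ e).
Qed.

Lemma perm_img f n : increasing f n -> perm_eq (img f n) (map f (iota 0 n)).
Proof.
move=> f_incr; apply: uniq_perm; first exact: fset_uniq.
  rewrite map_inj_in_uniq ?iota_uniq // => i j.
  rewrite !mem_iota /= !add0n => ? ? e.
  by apply: (increasing_inj f_incr) => //; rewrite e.
by move=> s; rewrite in_fset.
Qed.

Lemma sum_img f n (F : share R hash -> R) : increasing f n ->
  \sum_(s <- img f n) F s = \sum_(i < n) F (f i).
Proof.
move=> f_incr; rewrite (perm_big _ (perm_img f_incr)) big_map.
by rewrite -[n in iota 0 n]subn0 big_mkord.
Qed.

Lemma card_img f n : increasing f n -> #|` img f n| = n.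
Proof.
by move=> f_incr; rewrite (perm_size (perm_img f_incr)) size_map size_iota.
Qed.

Lemma card_img_lt f n i : increasing f n -> (i < n)%N ->
  #|` [fset s in img f n | tau s < tau (f i)]| = i.
Proof.
move=> f_incr i_lt; rewrite -[RHS](card_img (increasingW (ltnW i_lt) f_incr)).
congr #|` _|; apply/fsetP => s.
have -> : (s \in [fset s' in img f n | tau s' < tau (f i)]) =
  (s \in img f n) && (tau s < tau (f i)) by rewrite !inE.
apply/andP/imgP => [[/imgP[j j_lt ->]]|[j ji ->]].
  by rewrite (increasing_lt f_incr) // => ji; exists j.
have j_lt := ltn_trans ji i_lt.
by rewrite mem_img // (increasing_lt f_incr).
Qed.

(** Sorting by time gives the listing; injectivity of [tau] makes its order strict. Index [i] will
    then stand for rank [i.+1]. *)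
Lemma fset_listing P : P != fset0 -> {in P &, injective (@tau R hash)} ->
  exists f n, increasing f n.+1 /\ P = img f n.+1.
Proof.
move=> P0 Pinj; have [s0 s0P] := fset0Pn _ P0.
pose le := relpre (@tau R hash) (fun x y : R => x <= y).
pose l := sort le P.
have le_tr : transitive le by move=> ? ? ?; apply: le_trans.
have l_sorted : sorted le l by apply: sort_sorted => x y; exact: le_total.
have mem_l s : (s \in l) = (s \in P) by rewrite mem_sort.
have l_uniq : uniq l by rewrite sort_uniq fset_uniq.
have sl : (size l).-1.+1 = size l.
  by apply: prednK; rewrite -has_predT; apply/hasP; exists s0; rewrite ?mem_l.
exists (nth s0 l), (size l).-1; rewrite sl; split.
  move=> i j /andP[ij jl]; have il := ltn_trans ij jl.
  have le_ij : le (nth s0 l i) (nth s0 l j) by apply: (sorted_ltn_nth le_tr).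
  rewrite lt_neqAle [_ <= _]le_ij andbT.
  apply/eqP => /Pinj; rewrite -!mem_l !mem_nth // => /(_ isT isT)/eqP.
  by rewrite nth_uniq // ltn_eqF.
apply/fsetP => s; rewrite -mem_l; apply/idP/imgP => [/(nthP s0)[i ? <-]|].
  by exists i.
by case=> i ? ->; rewrite mem_nth.
Qed.

Lemma round_ofE H k s : s \in round H k -> round_of H s = round H k.
Proof.
move=> sk; rewrite /round_of.
suff /(rounds_disjoint sk) <- : s \in round H
  (find (fun P : {fset share R hash} => s \in P) (rounds H)) by [].
apply: (@nth_find _ fset0 (fun P : {fset share R hash} => s \in P)).
apply/hasP; exists (round H k) => //; apply: mem_nth.
by have [//|kH] := ltnP k (size (rounds H)); rewrite /round nth_default in sk.
Qed.

Lemma mem_round H s : s \in shares H ->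
  exists r : 'I_(size (rounds H)), s \in round H r.
Proof.
rewrite shares_cover => /bigfcupP[P /andP[/(nthP fset0)[k kH <-] _] sk].
by exists (Ordinal kH).
Qed.

Lemma rankE H k s : s \in round H k ->
  rank H s = #|` [fset s' in round H k | tau s' < tau s]|.+1.
Proof. by move=> sk; rewrite /rank (round_ofE sk). Qed.

Lemma round_listing H (r : 'I_(size (rounds H))) :
  exists f n, increasing f n.+1 /\ round H r = img f n.+1.
Proof.
apply: fset_listing; first exact: round_neq0.
move=> s s' /round_shares ? /round_shares ?; exact: (@tau_inj _ _ H).
Qed.

Lemma rank_listing H k f n i : increasing f n -> round H k = img f n ->
  (i < n)%N -> rank H (f i) = i.+1.
Proof.
move=> f_incr Hk i_lt; have := mem_img f i_lt; rewrite -Hk => /rankE->.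
by rewrite Hk card_img_lt.
Qed.

(** The shares are the union of the rounds and the remaining fields are proofs, so an equation on
    [rounds] is enough to identify a history. *)
Lemma history_eq H H' : rounds H = rounds H' -> H = H'.
Proof.
case: H => S rs S0 inj rs0 cov chr; case: H' => S' rs' S0' inj' rs0' cov' chr' /= e.
case: _ / e in rs0' cov' chr' *; have e : S = S' by rewrite cov cov'.
case: _ / e in S0' inj' cov' *.
by congr History; apply: Prop_irrelevance.
Qed.

End Listings.

(** * Real sequences: the recursion for awards and the series bound *)

Section Shares.
Variable R : realType.
Implicit Types (eps : nat -> R) (a : nat -> nat -> R) (T : R).

Definition fair_share eps k n : R :=
  eps k - \sum_(k.+1 <= i < n.+1) eps i / (i%:R - 1).

Lemma fair_shareS eps k n : (k <= n)%N ->
  fair_share eps k n.+1 = fair_share eps k n - eps n.+1 / n%:R.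
Proof.
move=> kn; rewrite /fair_share big_nat_recr ?ltnS //= opprD addrA.
by rewrite -(natrB _ (ltn0Sn n)) subn1.
Qed.

Lemma fair_share_diag eps n : fair_share eps n n = eps n.
Proof. by rewrite /fair_share big_geq ?subr0. Qed.

(** The newcomer at rank [n.+2] receives [eps n.+2], and each of the [n.+1] earlier shares gives up
    [eps n.+2 / n.+1]; the sum is thus the same for every size. *)
Lemma sum_fair_share eps n : \sum_(k < n.+1) fair_share eps k.+1 n.+1 = eps 1%N.
Proof.
elim: n => [|n IHn]; first by rewrite big_ord1 fair_share_diag.
rewrite big_ord_recr /= fair_share_diag.
under eq_bigr => k _ do rewrite fair_shareS //.
rewrite sumrB IHn sumr_const card_ord -[X in _ - X + _]mulr_natr divfK ?subrK //.
Qed.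

(* Indices are shifted to start at 0: [a k n] stands for the award of the share
   of rank k.+1 in a round of n.+1 shares. *)
Lemma redistribution_step a T n k :
  (forall m, \sum_(i < m.+1) a i m = T) ->
  (forall i j, (i <= n)%N -> (j <= n)%N ->
     a i n - a i n.+1 = a j n - a j n.+1) ->
  (k <= n)%N -> a k n.+1 = a k n - a n.+1 n.+1 / n.+1%:R.
Proof.
move=> a_sum a_redist kn; have n0 : n.+1%:R != 0 :> R by rewrite pnatr_eq0.
have e : (a k n - a k n.+1) * n.+1%:R = a n.+1 n.+1.
  rewrite mulr_natr -[in X in _ *+ X](card_ord n.+1) -sumr_const.
  rewrite (eq_bigr (fun i : 'I_n.+1 => a i n - a i n.+1)); last first.
    by move=> i _; apply: a_redist => //; rewrite -ltnS.
  by rewrite sumrB a_sum -(a_sum n.+1) big_ord_recr /= addrAC subrr add0r.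
by rewrite -e mulfK // opprB addrC subrK.
Qed.

Lemma fair_share_redistribution a T eps k n :
  (forall m, \sum_(i < m.+1) a i m = T) ->
  (forall m i j, (i <= m)%N -> (j <= m)%N ->
     a i m - a i m.+1 = a j m - a j m.+1) ->
  (forall m, T * eps m.+1 = a m m) ->
  (k <= n)%N -> a k n = T * fair_share eps k.+1 n.+1.
Proof.
move=> a_sum a_redist eps_a; elim: n k => [|n IHn] k.
  by rewrite leqn0 => /eqP ->; rewrite fair_share_diag eps_a.
rewrite leq_eqVlt ltnS => /orP[/eqP->|kn].
  by rewrite fair_share_diag eps_a.
rewrite (redistribution_step a_sum (a_redist n)) // fair_shareS //.
by rewrite mulrBr mulrA eps_a IHn.
Qed.

(** Nonnegative terms make the series converge in the extended reals, and nonnegativity of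
    [fair_share] eventually bounds its partial sums by [eps k]. *)
Lemma fair_share_series eps k :
  (forall n, (1 <= n)%N -> 0 <= eps n) ->
  (forall n, (k <= n)%N -> 0 <= fair_share eps k n) ->
  (\sum_(k.+1 <= i <oo) (eps i / (i%:R - 1))%:E <= (eps k)%:E)%E.
Proof.
move=> eps_ge0 fair_ge0; apply: lime_le.
  apply: is_cvg_nneseries => i ki _; rewrite lee_fin divr_ge0 ?eps_ge0 //.
    exact: leq_trans ki.
  by rewrite subr_ge0 ler1n; apply: leq_trans ki.
near=> n; rewrite sumEFin lee_fin.
have kn : (k < n)%N by near: n; exists k.+1.
(* The partial sum stops before [n], so it is the one inside [fair_share eps k n.-1]. *)
have := fair_ge0 n.-1; rewrite /fair_share (prednK (leq_ltn_trans (leq0n k) kn)).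
by rewrite subr_ge0; apply; rewrite -ltnS (prednK (leq_ltn_trans (leq0n k) kn)).
Unshelve. all: by end_near. Qed.

(* At T = 0 all awards vanish and [a n n / T] is 0; overriding the value at 1
   covers this degenerate case together with the generic one. *)
Lemma fair_shares_exist a T :
  (forall k n, (k <= n)%N -> 0 <= a k n) ->
  (forall n, \sum_(i < n.+1) a i n = T) ->
  (forall n i j, (i <= n)%N -> (j <= n)%N ->
     a i n - a i n.+1 = a j n - a j n.+1) ->
  exists eps, [/\ eps 1%N = 1,
    forall n, (1 <= n)%N -> 0 <= eps n <= 1,
    forall n, (1 <= n)%N ->
      (\sum_(n.+1 <= i <oo) (eps i / (i%:R - 1))%:E <= (eps n)%:E)%E &
    forall k n, (k <= n)%N -> a k n = T * fair_share eps k.+1 n.+1].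
Proof.
move=> a_ge0 a_sum a_redist.
have a00 : a 0%N 0%N = T by rewrite -(a_sum 0%N) big_ord1.
have a_le k n : (k <= n)%N -> a k n <= T.
  rewrite -ltnS => kn; rewrite -(a_sum n) (bigD1 (Ordinal kn)) //= lerDl.
  by apply: sumr_ge0 => i _; rewrite a_ge0 // -ltnS.
have T_ge0 : 0 <= T by rewrite -a00 a_ge0.
pose eps n := if n == 1%N then 1 else a n.-1 n.-1 / T.
have eps_a n : T * eps n.+1 = a n n.
  rewrite /eps; case: n => [|n] /=; first by rewrite mulr1.
  (* If [T = 0], the diagonal award is squeezed between 0 and [T]. *)
  have [T0|T0] := eqVneq T 0; last by rewrite mulrC divfK.
  by apply/eqP; rewrite T0 mul0r eq_le a_ge0 // -T0 a_le.
have a_fair k n : (k <= n)%N -> a k n = T * fair_share eps k.+1 n.+1.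
  exact: (fair_share_redistribution a_sum).
have eps_bounds n : (1 <= n)%N -> 0 <= eps n <= 1.
  case: n => // n _; rewrite /eps; case: eqP => _ /=; first by rewrite ler01 lexx.
  rewrite divr_ge0 ?a_ge0 //=; have [->|T0] := eqVneq T 0; first by rewrite invr0 mulr0.
  by rewrite ler_pdivrMr ?mul1r ?a_le // lt_def T0.
exists eps; split => // k k1; apply: fair_share_series => [n /eps_bounds/andP[]//|n kn].
(* If [T = 0], [a_fair] gives no sign for [fair_share]; but then [eps] vanishes above 1 and only
   [eps k] is left. *)
have [T0|T0] := eqVneq T 0.
  rewrite /fair_share big_nat big1 ?subr0 => [|i /andP[ki _]].
    by have /andP[] := eps_bounds k k1.
  by rewrite /eps ifN_eq ?T0 ?invr0 ?mulr0 ?mul0r // gtn_eqF // (leq_ltn_trans k1).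
have T_gt0 : 0 < T by rewrite lt_def T0.
case: k k1 kn => // k _; case: n => // n kn.
by rewrite -(pmulr_rge0 _ T_gt0) -a_fair ?a_ge0.
Qed.

End Shares.

(** * Fair schemes satisfy the axioms *)

Section FairSchemes.
Variables (R : realType) (hash : choiceType).
Implicit Types (H : history R hash) (s : share R hash) (P : {fset share R hash}).

(** With [p] selecting the shares earlier than a given one, this tells how a rank reacts to a share
    entering the round. *)
Lemma card_filterU1 P s (p : pred (share R hash)) : s \notin P ->
  #|` [fset x in s |` P | p x]| = (p s + #|` [fset x in P | p x]|)%N.
Proof.
move=> sP; case: (boolP (p s)) => ps.
  have -> : [fset x in s |` P | p x] = s |` [fset x in P | p x].
    by apply/fsetP => x; rewrite !inE; case: eqVneq => [->|].
  by rewrite cardfsU1 !inE (negbTE sP).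
congr #|` _|; apply/fsetP => x; rewrite !inE.
by case: eqVneq => [->|//]; rewrite (negbTE ps) !andbF.
Qed.

Lemma card_earlier_lt P s : s \in P ->
  (#|` [fset s' in P | (tau s' < tau s)%R]| < #|` P|)%N.
Proof.
move=> sP; rewrite [#|` P|](cardfsD1 s) sP ltnS; apply: fsubset_leq_card.
apply/fsubsetP => x; rewrite !inE => /andP[-> lt_xs]; rewrite andbT.
by apply: contraTneq lt_xs => ->; rewrite ltxx.
Qed.

Lemma next_share_listing H f n i : increasing f n -> shares H = img f n ->
  (i.+1 < n)%N -> next_share H (f i) (f i.+1).
Proof.
move=> f_incr Hf i_lt; have i_lt' := ltnW i_lt.
split; rewrite ?Hf ?mem_img // ?(increasing_lt f_incr) // => _ /imgP[k k_lt ->].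
by rewrite !(increasing_lt f_incr) // ltnS; apply/negP => /andP[]; case: leqP.
Qed.

(** The shifted share is bounded only by the neighbours of [si]. In the listing by time every other
    share lies at or beyond one of them, so no order is reversed. *)
Lemma time_shift_lt H (s si si' : share R hash) :
  s \in shares H -> si \in shares H -> s != si ->
  (forall x, next_share H x si -> tau x < tau si') ->
  (forall x, next_share H si x -> tau si' < tau x) ->
  (tau si' < tau s) = (tau si < tau s).
Proof.
have [f [n [f_incr Hf]]] := fset_listing (shares_neq0 H) (@tau_inj _ _ H).
rewrite Hf => /imgP[j j_lt ->] /imgP[i i_lt ->] ij prev next.
rewrite (increasing_lt f_incr) //.
case: (ltngtP i j) => [lt_ij|lt_ji|eq_ij]; last by rewrite eq_ij eqxx in ij.
  apply: lt_le_trans (next _ (next_share_listing f_incr Hf _)) _.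
    exact: leq_ltn_trans j_lt.
  by rewrite leNgt (increasing_lt f_incr) -?leqNgt // (leq_ltn_trans lt_ij).
apply/negbTE; rewrite -leNgt ltW //.
(* Some share precedes [si], so its index is a successor and the previous share exists. *)
case: i i_lt lt_ji prev {next ij} => // i i_lt ji prev.
apply: le_lt_trans (prev _ (next_share_listing f_incr Hf i_lt)).
by rewrite leNgt (increasing_lt f_incr) -?leqNgt // ltnW.
Qed.

Variables (alpha : reward_scheme R hash) (T : R) (eps : nat -> R).

Definition fair_scheme := forall H s, s \in shares H ->
  alpha s H = T * fair_share eps (rank H s) #|` round_of H s|.

(** Here the award is read off the set [round H k] alone, so comparing awards in two histories
    becomes a comparison of two sets. *)
Lemma fair_award H k s : fair_scheme -> s \in round H k ->
  alpha s H =
  T * fair_share eps #|` [fset s' in round H k | tau s' < tau s]|.+1 #|` round H k|.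
Proof.
move=> fair sk; rewrite fair ?(round_shares sk) //.
by rewrite (rankE sk) (round_ofE sk).
Qed.

Lemma fair_total H P : fair_scheme -> eps 1%N = 1 -> P \in rounds H ->
  \sum_(s <- P) alpha s H = T.
Proof.
move=> fair eps1 /(nthP fset0)[k kH <-].
have [f [n [f_incr Hf]]] := round_listing (Ordinal kH).
rewrite /= in Hf; rewrite -/(round H k) Hf sum_img //.
rewrite (eq_bigr (fun i : 'I_n.+1 => T * fair_share eps i.+1 n.+1)) => [|i _].
  by rewrite -mulr_sumr sum_fair_share eps1 mulr1.
by rewrite (@fair_award _ k) ?Hf ?mem_img // card_img_lt // card_img.
Qed.

Lemma fair_round_based : fair_scheme -> round_based_rewards alpha.
Proof.
move=> fair H r s sr; rewrite (fair_award fair sr).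
by rewrite (@fair_award (restrict r) 0 s fair sr).
Qed.

(** The old and the new round both add one share to [round H r] without [si]. They have the same
    size, and by [time_shift_lt] the added share counts alike in the rank of [s]. *)
Lemma fair_ordinality : fair_scheme -> ordinality alpha.
Proof.
move=> fair H si H' siH [r [si' [sir si'H [prev next] _ [H'k H'r]]]] s.
rewrite in_fsetD1 => /andP[s_si sH]; have [k sk] := mem_round sH.
have [kr|kr] := eqVneq (k : nat) r; last first.
  by rewrite (fair_award fair sk) (@fair_award H' k) ?H'k.
rewrite kr in sk; rewrite (fair_award fair sk) (@fair_award H' r) ?H'r; last first.
- by rewrite in_fset1U in_fsetD1 s_si sk orbT.
- exact: fair.
have si'Q : si' \notin round H r `\ si.
  by apply: contra si'H; rewrite in_fsetD1 => /andP[_ /round_shares].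
have -> : round H r = si |` (round H r `\ si) by rewrite fsetD1K.
have siQ : si \notin round H r `\ si by rewrite in_fsetD1 eqxx.
rewrite fsetU1K // !card_filterU1 // !cardfsU1 siQ si'Q.
by rewrite (time_shift_lt sH siH s_si prev next).
Qed.

(** The new share comes after the whole round: ranks stay, and each award loses the same new term of
    the sum, which depends on the size of the round only. *)
Lemma fair_redistribution : fair_scheme -> absolute_redistribution alpha.
Proof.
move=> fair H r H' _ [s' [s'H [after _] _ _ H'r]].
have s'r : s' \notin round H r by apply: contra s'H => /round_shares.
suff drop s : s \in round H r ->
    alpha s H - alpha s H' = T * (eps #|` round H r|.+1 / #|` round H r|%:R).
  by move=> si sj /drop-> /drop->.
move=> sr; rewrite (fair_award fair sr) (@fair_award H' r) ?H'r //; last first.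
  by rewrite in_fset1U sr orbT.
rewrite card_filterU1 // cardfsU1 s'r ltNge ltW ?after //= add0n add1n.
by rewrite fair_shareS ?card_earlier_lt // -mulrBr opprB addrC subrK.
Qed.

End FairSchemes.

(** * Histories with prescribed rounds *)

Section Schemes.
Variables (R : realType) (hash : choiceType) (alpha : reward_scheme R hash).
Implicit Types (H : history R hash) (P : {fset share R hash}).
Implicit Types (f g : nat -> share R hash).

Lemma single_history f n : increasing f n.+1 ->
  exists H, rounds H = [:: img f n.+1].
Proof.
move=> f_incr; have nz : fset0 \notin [:: img f n.+1].
  by rewrite inE eq_sym img_neq0.
have cover : img f n.+1 = \bigcup_(P <- [:: img f n.+1]) P by rewrite big_seq1.
unshelve eexists (History (img_neq0 f n) (tau_inj_img f_incr) nz cover _) => //.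
by move=> j [|k] /andP[]; rewrite ?ltn0.
Qed.

Lemma double_history f g m n : increasing f m.+1 -> increasing g n.+1 ->
  (forall i j, (i <= m)%N -> (j <= n)%N -> tau (f i) < tau (g j)) ->
  exists H, rounds H = [:: img f m.+1; img g n.+1].
Proof.
move=> f_incr g_incr fg; pose P := img f m.+1; pose Q := img g n.+1.
have lt_PQ s s' : s \in P -> s' \in Q -> tau s < tau s'.
  by move=> /imgP[i ? ->] /imgP[j ? ->]; apply: fg.
have nz : fset0 \notin [:: P; Q] by rewrite !inE !(eq_sym fset0) !negb_or !img_neq0.
have cover : P `|` Q = \bigcup_(A <- [:: P; Q]) A by rewrite big_cons big_seq1.
have PQ0 : P `|` Q != fset0.
  by apply/fset0Pn; exists (f 0%N); rewrite in_fsetU mem_img.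
have inj : {in P `|` Q &, injective (@tau R hash)}.
  move=> s s'; rewrite !in_fsetU => /orP[] sP /orP[] s'P e.
  - exact: (tau_inj_img f_incr).
  - by have := lt_PQ _ _ sP s'P; rewrite e ltxx.
  - by have := lt_PQ _ _ s'P sP; rewrite e ltxx.
  - exact: (tau_inj_img g_incr).
unshelve eexists (History PQ0 inj nz cover _) => //.
by move=> [|j] [|[|k]]; rewrite ?ltnS ?ltn0 ?andbF //= => _; exact: lt_PQ.
Qed.

(** Reference rounds of any size, later than given shares: the hash [h] is repeated at times [M],
    [M + 1] and so on, with [M] above all times in [P]. *)
Lemma later_listing (h : hash) P : exists g,
  (forall n, increasing g n) /\ forall s j, s \in P -> tau s < tau (g j).
Proof.
have [M MP] : exists M : R, forall s, s \in (P : seq _) -> tau s < M.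
  elim: (P : seq _) => [|s l [M lM]]; first by exists 0.
  exists (Num.max M (tau s + 1)) => s'; rewrite inE lt_max.
  by case/orP => [/eqP->|/lM-> //]; rewrite ltrDl ltr01 orbT.
exists (fun j => (h, M + j%:R)); split.
  by move=> n i j /andP[ij _]; rewrite /tau /= ltrD2l ltr_nat.
by move=> s j /MP sM; rewrite /tau /= (lt_le_trans sM) // lerDl.
Qed.

(** * Awards depend only on rank and round size *)

Section RoundBased.
Hypotheses (rb : round_based_rewards alpha) (fixed : fixed_total_reward alpha).

Lemma award_single H (r : 'I_(size (rounds H))) H1 s :
  rounds H1 = [:: round H r] -> s \in round H r -> alpha s H = alpha s H1.
Proof. by move=> H1r sr; rewrite (rb sr); congr (alpha s _); apply: history_eq. Qed.

(** Fixed total reward compares rounds of one history, so the two rounds are placed in a common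
    history [D]; round based rewards transfers the awards. *)
Lemma total_before f g m n H H' : increasing f m.+1 -> increasing g n.+1 ->
  rounds H = [:: img f m.+1] -> rounds H' = [:: img g n.+1] ->
  (forall i j, (i <= m)%N -> (j <= n)%N -> tau (f i) < tau (g j)) ->
  \sum_(i < m.+1) alpha (f i) H = \sum_(j < n.+1) alpha (g j) H'.
Proof.
move=> f_incr g_incr Hf H'g fg; have [D rD] := double_history f_incr g_incr fg.
have D0 : (0 < size (rounds D))%N by rewrite rD.
have D1 : (1 < size (rounds D))%N by rewrite rD.
have Df : round D 0 = img f m.+1 by rewrite /round rD.
have Dg : round D 1 = img g n.+1 by rewrite /round rD.
have := @fixed D (img f m.+1) (img g n.+1).
rewrite rD !inE !eqxx orbT => /(_ isT isT); rewrite !sum_img // => e.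
transitivity (\sum_(i < m.+1) alpha (f i) D).
  apply: eq_bigr => i _; symmetry; apply: (@award_single D (Ordinal D0)).
    by rewrite [round D _]Df.
  by rewrite [round D _]Df mem_img.
rewrite e; apply: eq_bigr => i _; apply: (@award_single D (Ordinal D1)).
  by rewrite [round D _]Dg.
by rewrite [round D _]Dg mem_img.
Qed.

(** The two rounds may overlap in time; each is compared with the same later round of one share. *)
Lemma total_constant f g m n H H' : increasing f m.+1 -> increasing g n.+1 ->
  rounds H = [:: img f m.+1] -> rounds H' = [:: img g n.+1] ->
  \sum_(i < m.+1) alpha (f i) H = \sum_(j < n.+1) alpha (g j) H'.
Proof.
move=> f_incr g_incr Hf H'g.
have [k [k_incr kfg]] := later_listing (f 0%N).1 (img f m.+1 `|` img g n.+1).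
have [K rK] := single_history (k_incr 1%N).
transitivity (\sum_(i < 1) alpha (k i) K); [|symmetry].
  apply: (total_before f_incr (k_incr 1%N)) => // i j im _.
  by apply: kfg; rewrite in_fsetU mem_img.
apply: (total_before g_incr (k_incr 1%N)) => // i j im _.
by apply: kfg; rewrite in_fsetU mem_img ?orbT.
Qed.

Hypothesis ord : ordinality alpha.

(* Ordinality is silent about the shifted share itself, whose award is the
   rest of the fixed total. *)
Lemma award_shift f g n j H H' : increasing f n.+1 -> increasing g n.+1 ->
  rounds H = [:: img f n.+1] -> rounds H' = [:: img g n.+1] ->
  (j <= n)%N -> (forall i, (i <= n)%N -> i != j -> f i = g i) ->
  forall i, (i <= n)%N -> alpha (f i) H = alpha (g i) H'.
Proof.
move=> f_incr g_incr Hf H'g jn fg.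
(* A time-shift needs a share outside [H]. If the share at [j] stays put, the two histories are
   equal. *)
have [fgj|fgj] := eqVneq (f j) (g j).
  have fg' i : (i <= n)%N -> f i = g i by have [->//|] := eqVneq i j => ? /fg->.
  move=> i le_in; rewrite fg' //; congr (alpha _ _); apply: history_eq.
  by rewrite Hf H'g; congr [:: _]; apply: eq_img => k /fg'.
have sH : shares H = img f n.+1 by rewrite shares_cover Hf big_seq1.
have sH' : shares H' = img g n.+1 by rewrite shares_cover H'g big_seq1.
have H0 : (0 < size (rounds H))%N by rewrite Hf.
have gj_f : g j \notin img f n.+1.
  apply/imgP => -[i le_in]; have [->|ij] := eqVneq i j.
    by move/esym/eqP; rewrite (negbTE fgj).
  rewrite fg // => /(congr1 (@tau R hash)) /(increasing_inj g_incr) e.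
  by rewrite e ?eqxx in ij.
have img_g : img g n.+1 = g j |` (img f n.+1 `\ f j).
  apply/fsetP => s; rewrite in_fset1U in_fsetD1; apply/imgP/orP.
    move=> [i le_in ->]; have [->|ij] := eqVneq i j; [by left|right].
    rewrite -fg // mem_img // andbT; apply: contra_neq ij.
    by move=> /(congr1 (@tau R hash)) /(increasing_inj f_incr) ->.
  case=> [/eqP->|/andP[sj /imgP[i le_in e]]]; first by exists j.
  exists i => //; rewrite e fg //; apply: contraNneq sj => ij.
  by rewrite e ij.
have shift : time_shift H (f j) H'.
  exists (Ordinal H0), (g j); split; rewrite ?sH ?sH' //=.
  - by rewrite /round Hf mem_img.
  (* A neighbour of [f j] is some [f i] with [i != j], hence equals [g i], and [g] being increasing
     puts [g j] on the right side of it. *)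
  - split=> s []; rewrite sH.
      move=> /imgP[i le_in ->] _; rewrite (increasing_lt f_incr) // => lt_ij _.
      by rewrite fg ?ltn_eqF // (increasing_lt g_incr).
    move=> _ /imgP[i le_in ->]; rewrite (increasing_lt f_incr) // => lt_ji _.
    by rewrite fg ?gtn_eqF // (increasing_lt g_incr).
  - by rewrite /round Hf H'g; split=> // -[|[]].
have ne i : (i <= n)%N -> i != j -> alpha (f i) H = alpha (g i) H'.
  move=> le_in ij; rewrite -fg //; apply: (ord _ shift); rewrite ?sH ?mem_img //.
  rewrite in_fsetD1 mem_img // andbT; apply: contra_neq ij.
  by move=> /(congr1 (@tau R hash)) /(increasing_inj f_incr) ->.
move=> i le_in; have [->|/ne-> //] := eqVneq i j.
have := total_constant f_incr g_incr Hf H'g.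
have jn1 : (j < n.+1)%N by [].
rewrite (bigD1 (Ordinal jn1)) //= [RHS](bigD1 (Ordinal jn1)) //=.
rewrite [X in _ + X](eq_bigr (fun i : 'I_n.+1 => alpha (g i) H')); first exact: addIr.
by move=> k kj; apply: ne => //; rewrite -ltnS.
Qed.

Lemma award_before f g n H H' : increasing f n.+1 -> increasing g n.+1 ->
  rounds H = [:: img f n.+1] -> rounds H' = [:: img g n.+1] ->
  (forall i j, (i <= n)%N -> (j <= n)%N -> tau (f i) < tau (g j)) ->
  forall i, (i <= n)%N -> alpha (f i) H = alpha (g i) H'.
Proof.
move=> f_incr g_incr Hf H'g fg.
(* Hybrid rounds between [f] at [k = n.+1] and [g] at [k = 0]. They are increasing because [f] lies
   before [g], and [mix k.+1] differs from [mix k] at index [k] only. *)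
pose mix k i := if (i < k)%N then f i else g i.
have mix_incr k : increasing (mix k) n.+1.
  move=> i j /andP[ij jn]; have i_n := ltn_trans ij jn; rewrite /mix.
  case: ltnP => [ik|ki]; case: ltnP => [jk|kj].
  - by apply: f_incr; rewrite ij.
  - exact: fg.
  - by have := leq_ltn_trans ki (ltn_trans ij jk); rewrite ltnn.
  - by apply: g_incr; rewrite ij.
have mix_award k : (k <= n.+1)%N -> forall K, rounds K = [:: img (mix k) n.+1] ->
    forall i, (i <= n)%N -> alpha (mix k i) K = alpha (g i) H'.
  elim: k => [|k IHk] kn K rK i le_in.
    by congr (alpha _ _); apply: history_eq; rewrite rK H'g.
  have [K' rK'] := single_history (mix_incr k).
  rewrite -(IHk (ltnW kn) K' rK' i le_in).
  apply: (award_shift (mix_incr k.+1) (mix_incr k) rK rK' kn) => // l _ lk.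
  by rewrite /mix ltnS leq_eqVlt (negbTE lk).
move=> i le_in; have mixE l : (l <= n)%N -> mix n.+1 l = f l by rewrite /mix ltnS => ->.
rewrite -(mix_award n.+1 (leqnn _) H _ i le_in) ?mixE // Hf; congr [:: _].
by apply: eq_img => l; rewrite ltnS => /mixE.
Qed.

(** A detour through a round [K] of the same size, later than both, reduces the general case to
    [award_before]. *)
Lemma award_listing f g n H H' : increasing f n.+1 -> increasing g n.+1 ->
  rounds H = [:: img f n.+1] -> rounds H' = [:: img g n.+1] ->
  forall i, (i <= n)%N -> alpha (f i) H = alpha (g i) H'.
Proof.
move=> f_incr g_incr Hf H'g i le_in.
have [k [k_incr kfg]] := later_listing (f 0%N).1 (img f n.+1 `|` img g n.+1).
have [K rK] := single_history (k_incr n.+1).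
transitivity (alpha (k i) K); [|symmetry].
  apply: (award_before f_incr (k_incr n.+1)) => // l j ln _.
  by apply: kfg; rewrite in_fsetU mem_img.
apply: (award_before g_incr (k_incr n.+1)) => // l j ln _.
by apply: kfg; rewrite in_fsetU mem_img ?orbT.
Qed.

End RoundBased.

(** * From the axioms to the award formula, and back *)

Lemma redistribution_listing f n H H' : absolute_redistribution alpha ->
  increasing f n.+2 -> rounds H = [:: img f n.+1] -> rounds H' = [:: img f n.+2] ->
  forall i j, (i <= n)%N -> (j <= n)%N ->
  alpha (f i) H - alpha (f i) H' = alpha (f j) H - alpha (f j) H'.
Proof.
move=> redist f_incr Hf H'f i j le_in le_jn.
(* Absolute redistribution is silent about rounds of one share, but there [i] and [j] coincide. *)
case: n => [|n] in f_incr Hf H'f le_in le_jn *.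
  by move: le_in le_jn; rewrite !leqn0 => /eqP-> /eqP->.
have H0 : (0 < size (rounds H))%N by rewrite Hf.
have rH : round H 0 = img f n.+2 by rewrite /round Hf.
have rH' : round H' 0 = img f n.+3 by rewrite /round H'f.
have sH : shares H = img f n.+2 by rewrite shares_cover Hf big_seq1.
have sH' : shares H' = img f n.+3 by rewrite shares_cover H'f big_seq1.
have f_incr' := increasingW (leqnSn _) f_incr.
apply: (@redist H (Ordinal H0) H'); rewrite /= ?rH ?mem_img ?card_img //.
exists (f n.+2); rewrite /= sH sH' rH rH'; split; [| |exact: imgS| |exact: imgS].
- apply/imgP => -[k k_lt /(congr1 (@tau R hash)) /(increasing_inj f_incr) e].
  by have := k_lt; rewrite -e ?ltnn // ltnW.
- split=> s; last by rewrite /round Hf.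
  by move=> /imgP[k k_lt ->]; apply: f_incr; rewrite k_lt /=.
- by rewrite /round Hf H'f => -[|[]].
Qed.

Lemma axioms_fair (B : R) : inhabited hash ->
  round_based_rewards alpha -> budget_limit alpha B -> fixed_total_reward alpha ->
  ordinality alpha -> absolute_redistribution alpha -> absolute_fair alpha B.
Proof.
move=> [h] rb budget fixed ord redist.
(* One sequence [g] serves all sizes, so that [canon n.+1] extends [canon n]. *)
have [g [g_incr _]] := later_listing h fset0.
have /choice[canon canonE] n : exists H, rounds H = [:: img g n.+1].
  exact: single_history.
pose a k n := alpha (g k) (canon n); pose T := a 0%N 0%N.
have scanon n : shares (canon n) = img g n.+1.
  by rewrite shares_cover canonE big_seq1.
have a_ge0 k n : (k <= n)%N -> 0 <= a k n.
  by move=> kn; apply: award_ge0; rewrite scanon mem_img.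
have a_sum n : \sum_(i < n.+1) a i n = T.
  have := total_constant rb fixed (g_incr _) (g_incr 1%N) (canonE n) (canonE 0%N).
  by rewrite big_ord1.
have a_redist n i j : (i <= n)%N -> (j <= n)%N ->
    a i n - a i n.+1 = a j n - a j n.+1.
  exact: (redistribution_listing redist (g_incr _) (canonE n) (canonE n.+1)).
have T_le : T <= B.
  have := @budget (canon 0%N) (img g 1); rewrite canonE inE eqxx => /(_ isT).
  by rewrite sum_img // big_ord1.
have [eps [eps1 eps_bounds eps_series a_fair]] := fair_shares_exist a_ge0 a_sum a_redist.
(* The fee [f = B - T] makes the constant [B - f] equal to the common total [T]. *)
exists (B - T), eps; split => //.
  by rewrite subr_ge0 T_le gerBl a_ge0.
move=> H s /mem_round[r sr]; rewrite subKr (rb _ _ _ sr).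
have [f [n [f_incr rf]]] := round_listing r.
rewrite (round_ofE sr); move: (sr); rewrite rf => /imgP[i i_lt sE].
rewrite sE (rank_listing f_incr rf) // card_img // -/(fair_share _ _ _) -a_fair //.
apply: (award_listing rb fixed ord f_incr (g_incr n.+1)) => //=.
by rewrite rf.
Qed.

Lemma fair_axioms (B : R) : absolute_fair alpha B ->
  [/\ round_based_rewards alpha, budget_limit alpha B,
      fixed_total_reward alpha, ordinality alpha
    & absolute_redistribution alpha].
Proof.
move=> [f [eps [/andP[f_ge0 _] eps1 _ _ fair]]].
have {}fair : fair_scheme alpha (B - f) eps by [].
split.
- exact: fair_round_based fair.
- by move=> H P PH; rewrite (fair_total fair eps1 PH) gerBl.
- by move=> H P P' PH P'H; rewrite !(fair_total fair eps1).
- exact: fair_ordinality fair.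
- exact: fair_redistribution fair.
Qed.

End Schemes.

Theorem theorem1 (R : realType) (hash : choiceType) (hash_nonempty : inhabited hash)
    (B : R) (B_gt0 : 0 < B) (alpha : reward_scheme R hash) :
  [/\ round_based_rewards alpha, budget_limit alpha B,
      fixed_total_reward alpha, ordinality alpha
    & absolute_redistribution alpha]
  <-> absolute_fair alpha B.
Proof. by split=> [[? ? ? ? ?]|]; [exact: axioms_fair|exact: fair_axioms]. Qed.
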